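(* Let $\mathcal{G}=(V,E(\mathcal{G}))$ and $\mathcal{H}=(V',E(\mathcal{H}))$ be two finite hypergraphs. Assume that $\sigma\in L_V$ and $\tau\in L_{V'}$ are linear orderings such that $\zeta({\rm KG}(\mathcal{G}))=|V|-alt_\sigma(\mathcal{G})$ and $\zeta({\rm KG}(\mathcal{H}))=|V'|-alt_\tau(\mathcal{H})$. If $$\max\{|V|+alt_\tau(\mathcal{H}),\ |V'|+alt_\sigma(\mathcal{G})\}\geq salt_\sigma(\mathcal{G})+salt_\tau(\mathcal{H}),$$ then $$\zeta({\rm KG}(\mathcal{G})\times{\rm KG}(\mathcal{H}))\geq\min\{\zeta({\rm KG}(\mathcal{G})),\zeta({\rm KG}(\mathcal{H}))\}.$$ Here $\zeta$ denotes the altermatic number and $\times$ the categorical product of graphs.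
   Context: Graphs are finite, simple, undirected, with nonempty vertex set. A hypergraph $\mathcal{H}=(V(\mathcal{H}),E(\mathcal{H}))$ consists of a nonempty finite vertex set $V(\mathcal{H})$ and a set $E(\mathcal{H})$ of distinct nonempty subsets of $V(\mathcal{H})$ (isolated vertices and singleton edges are allowed). The general Kneser graph ${\rm KG}(\mathcal{H})$ has vertex set $E(\mathcal{H})$, two vertices being adjacent iff the corresponding edges are disjoint. A homomorphism $G\to H$ of graphs is an adjacency-preserving map $V(G)\to V(H)$. Write $G\longleftrightarrow H$ (homomorphically equivalent) if there are homomorphisms $G\to H$ and $H\to G$. For $X=(x_1,\dots,x_n)\in\{-1,0,+1\}^n$, the alternation number $alt(X)$ is the length of a longest subsequence of nonzero entries of $X$ in which any two consecutive terms have opposite signs; $alt((0,\dots,0))=0$. For a set $V$ of size $n$ let $L_V$ be the set of linear orderings of $V$; for $\sigma\in L_V$ let $\sigma(j)$ be the $j$-th element of $V$ in the ordering $\sigma$, and put $X^+_\sigma=\{\sigma(j): x_j=+1\}$ and $X^-_\sigma=\{\sigma(j): x_j=-1\}$. For a hypergraph $\mathcal{H}$ with $n=|V(\mathcal{H})|$ and $\sigma\in L_{V(\mathcal{H})}$: $alt_\sigma(\mathcal{H})$ is the largest integer $k$ such that there is $X\in\{-1,0,+1\}^n$ with $alt(X)=k$ such that neither $X^+_\sigma$ nor $X^-_\sigma$ contains (as a subset) an edge of $\mathcal{H}$; $salt_\sigma(\mathcal{H})$ is the largest integer $k$ such that there is $X\in\{-1,0,+1\}^n$ with $alt(X)=k$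 such that at most one of $X^+_\sigma$ and $X^-_\sigma$ contains an edge of $\mathcal{H}$. Set $alt(\mathcal{H})=\min_{\sigma\in L_{V(\mathcal{H})}} alt_\sigma(\mathcal{H})$. The altermatic number of a graph $G$ is $$\zeta(G)=\max_{\mathcal{H}}\{|V(\mathcal{H})|-alt(\mathcal{H}): {\rm KG}(\mathcal{H})\longleftrightarrow G\},$$ the maximum being over all hypergraphs $\mathcal{H}$ with ${\rm KG}(\mathcal{H})\longleftrightarrow G$. (The maximum exists: it is a known theorem that it is bounded above by the chromatic number $\chi(G)$.) The categorical product $G\times H$ has vertex set $V(G)\times V(H)$, with $(u_1,u_2)$ and $(v_1,v_2)$ adjacent iff $u_1v_1\in E(G)$ and $u_2v_2\in E(H)$. *)

(* Defs.v *)
From mathcomp Require Import all_boot.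

Set Implicit Arguments.
Unset Strict Implicit.
Unset Printing Implicit Defensive.

(* The vertex type may be empty, so that the Kneser graph of an edgeless
   hypergraph is still a graph. *)
Record sgraph := SGraph {
  svertex :> finType;
  adj : rel svertex;
  adj_sym : symmetric adj;
  adj_irr : irreflexive adj }.

Definition hom (G H : sgraph) : Prop :=
  exists f : G -> H, forall u v : G, adj u v -> adj (f u) (f v).

Definition hom_equiv (G H : sgraph) : Prop := hom G H /\ hom H G.

Section CategoricalProduct.
Variables G H : sgraph.

Definition prod_adj : rel (G * H) :=
  fun u v => adj u.1 v.1 && adj u.2 v.2.

Lemma prod_adj_sym : symmetric prod_adj.
Proof. by move=> u v; rewrite /prod_adj (adj_sym u.1) (adj_sym u.2). Qed.

Lemma prod_adj_irr : irreflexive prod_adj.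
Proof. by move=> u; rewrite /prod_adj adj_irr. Qed.

Definition gprod : sgraph := SGraph prod_adj_sym prod_adj_irr.

End CategoricalProduct.

Record hypergraph := Hypergraph {
  hvertex : finType;
  hedge : {set {set hvertex}};
  hvertex_gt0 : 0 < #|hvertex|;
  hedge_neq0 : set0 \notin hedge }.

Section Kneser.
Variable H : hypergraph.

Definition kneser_vertex := {e : {set hvertex H} | e \in hedge H}.

Definition kneser_adj : rel kneser_vertex :=
  fun e f => [disjoint val e & val f].

Lemma kneser_adj_sym : symmetric kneser_adj.
Proof. by move=> e f; rewrite /kneser_adj disjoint_sym. Qed.

Lemma kneser_adj_irr : irreflexive kneser_adj.
Proof.
move=> [e He]; rewrite /kneser_adj /= -setI_eq0 setIid.
by apply: contraNF (hedge_neq0 H) => /eqP <-.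
Qed.

Definition KG : sgraph := SGraph kneser_adj_sym kneser_adj_irr.

End Kneser.

(* Entries of a sign vector: None is 0, Some true is +1, Some false is -1. *)
Definition sign := option bool.

(* Distinct nonzero signs are opposite. *)
Definition alternating (s : seq sign) : bool :=
  (None \notin s) && sorted (fun x y => x != y) s.

(* The subsequences of X are the sequences mask m X. *)
Definition alternation (n : nat) (X : n.-tuple sign) : nat :=
  \max_(m : n.-tuple bool | alternating (mask m X)) size (mask m X).

(* A linear ordering lists every element of V exactly once; its j-th element
   is tnth (val s) j. *)
Definition lin_order (V : finType) := {s : #|V|.-tuple V | uniq s}.

Definition sign_class (V : finType) (s : lin_order V)
    (X : #|V|.-tuple sign) (b : bool) : {set V} :=
  [set tnth (val s) j | j : 'I_#|V| & tnth X j == Some b].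

Definition contains_edge (H : hypergraph) (A : {set hvertex H}) : bool :=
  [exists e in hedge H, e \subset A].

(* The zero vector is admissible in both maxima below, edges being nonempty,
   so neither is a maximum over an empty family. *)
Definition alt_ord (H : hypergraph) (s : lin_order (hvertex H)) : nat :=
  \max_(X : #|hvertex H|.-tuple sign |
          ~~ contains_edge (sign_class s X true) &&
          ~~ contains_edge (sign_class s X false)) alternation X.

Definition salt_ord (H : hypergraph) (s : lin_order (hvertex H)) : nat :=
  \max_(X : #|hvertex H|.-tuple sign |
          ~~ (contains_edge (sign_class s X true) &&
              contains_edge (sign_class s X false))) alternation X.

(* The default value #|hvertex H| does not affect the minimum: orderings exist
   and alt_ord never exceeds the number of vertices (alt_ord_le). *)
Definition alt (H : hypergraph) : nat :=
  \big[minn/#|hvertex H|]_(s : lin_order (hvertex H)) alt_ord s.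

Lemma alt_ord_le (H : hypergraph) (s : lin_order (hvertex H)) :
  alt_ord s <= #|hvertex H|.
Proof.
apply/bigmax_leqP => X _; apply/bigmax_leqP => m _.
by rewrite size_mask ?size_tuple // (leq_trans (count_size _ _)) ?size_tuple.
Qed.

Lemma lin_order_inhabited (V : finType) : inhabited (lin_order V).
Proof.
have szE : size (enum V) == #|V| by rewrite cardE.
by constructor; exists (Tuple szE); apply: enum_uniq.
Qed.

(* The subtraction is never truncated, by alt_ord_le. *)
Definition altermatic_value (G : sgraph) (k : nat) : Prop :=
  exists2 H : hypergraph, hom_equiv (KG H) G & k = #|hvertex H| - alt H.

(* z is the altermatic number of G, i.e. the maximum of its altermatic values.
   That this maximum exists is a theorem (the values are at most the chromatic
   number of G), hence a relation rather than a function. *)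
Definition altermatic_number (G : sgraph) (z : nat) : Prop :=
  altermatic_value G z /\ forall k, altermatic_value G k -> k <= z.

Lemma altermatic_number_uniq (G : sgraph) (z1 z2 : nat) :
  altermatic_number G z1 -> altermatic_number G z2 -> z1 = z2.
Proof.
by move=> [v1 m1] [v2 m2]; apply/eqP; rewrite eqn_leq m2 // m1.
Qed.

(* Main.v *)
Require Import Defs.
From mathcomp Require Import all_boot.

(** Take the hypergraph on the disjoint union of the two vertex sets whose
edges are the unions of an edge of [G] and an edge of [H]: its Kneser graph is
equivalent to [KG G] x [KG H].  Order it by [sigma] followed by [tau], and split
an admissible sign vector as X = (Y, Z), so that alt X <= alt Y + alt Z.
Each sign class of X misses an edge either on the [G] side or on the [H] side.
If both miss on the same side, that side contributes at most [alt_ord] and the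
other at most its number of vertices; if they miss on different sides, the sum
is at most [salt_ord sigma + salt_ord tau], which the hypothesis controls. *)

Set Implicit Arguments.
Unset Strict Implicit.
Unset Printing Implicit Defensive.

Definition sum_set (A B : finType) (e : {set A}) (f : {set B}) : {set A + B} :=
  [set x | match x with inl a => a \in e | inr b => b \in f end].

Lemma preim_inl_sum_set (A B : finType) (e : {set A}) (f : {set B}) :
  inl @^-1: sum_set e f = e.
Proof. by apply/setP => x; rewrite !inE. Qed.

Lemma preim_inr_sum_set (A B : finType) (e : {set A}) (f : {set B}) :
  inr @^-1: sum_set e f = f.
Proof. by apply/setP => x; rewrite !inE. Qed.

Lemma disjoint_sum_set (A B : finType) (e e' : {set A}) (f f' : {set B}) :
  [disjoint e & e'] -> [disjoint f & f'] ->
  [disjoint sum_set e f & sum_set e' f'].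
Proof.
move=> /pred0P de /pred0P df; apply/pred0P => -[x|x] /=; rewrite !inE.
  exact: de x.
exact: df x.
Qed.

Lemma disjoint_preimset (A B : finType) (g : A -> B) (u v : {set B}) :
  [disjoint u & v] -> [disjoint g @^-1: u & g @^-1: v].
Proof. by move=> /pred0P d; apply/pred0P => x /=; rewrite !inE; apply: d. Qed.

Section SumHypergraph.
Variables G H : hypergraph.

(** A subset of the disjoint union is determined by its two preimages, so these are exactly the sets
    [sum_set e f] with [e] and [f] edges; the preimage form yields both edges directly. *)
Definition sum_hedge : {set {set hvertex G + hvertex H}} :=
  [set w : {set hvertex G + hvertex H} |
    (inl @^-1: w \in hedge G) && (inr @^-1: w \in hedge H)].

Lemma sum_hvertex_gt0 : 0 < #|{: hvertex G + hvertex H}|.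
Proof. by rewrite card_sum addn_gt0 hvertex_gt0. Qed.

Lemma sum_hedge_neq0 : set0 \notin sum_hedge.
Proof. by rewrite inE preimset0 (negPf (hedge_neq0 G)). Qed.

Definition sum_hypergraph : hypergraph :=
  Hypergraph sum_hvertex_gt0 sum_hedge_neq0.

Lemma sum_set_hedge (e : {set hvertex G}) (f : {set hvertex H}) :
  e \in hedge G -> f \in hedge H -> sum_set e f \in hedge sum_hypergraph.
Proof.
by move=> eG fH; rewrite inE preim_inl_sum_set preim_inr_sum_set eG fH.
Qed.

Definition kneser_of (K : hypergraph) (e : {set hvertex K})
    (eK : e \in hedge K) : KG K :=
  exist (fun e => e \in hedge K) e eK.

(** Two unions are disjoint iff they are disjoint on each side, so splitting an edge into its two
    traces and gluing a pair of edges both preserve adjacency. *)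
Lemma KG_sum_hypergraph : hom_equiv (KG sum_hypergraph) (gprod (KG G) (KG H)).
Proof.
have hl (w : KG sum_hypergraph) : inl @^-1: val w \in hedge G.
  by have := valP w; rewrite inE => /andP[].
have hr (w : KG sum_hypergraph) : inr @^-1: val w \in hedge H.
  by have := valP w; rewrite inE => /andP[].
split.
  exists (fun w => (kneser_of (hl w), kneser_of (hr w))) => u v uv.
  by apply/andP; split; apply: disjoint_preimset.
exists (fun p => kneser_of (sum_set_hedge (valP p.1) (valP p.2))).
by move=> u v /andP[]; apply: disjoint_sum_set.
Qed.

End SumHypergraph.

(** A duplicate-free list of length [#|V|] exhausts [V]. *)
Lemma mem_lin_order (V : finType) (s : lin_order V) (x : V) : x \in val s.
Proof.
have s_enum : {subset val s <= enum V} by move=> y _; rewrite mem_enum.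
have [|_ ->] := uniq_min_size (valP s) s_enum; last by rewrite mem_enum.
by rewrite -cardE size_tuple.
Qed.

Lemma index_lin_order (V : finType) (s : lin_order V) (x : V) :
  index x (val s) < #|V|.
Proof. by have := mem_lin_order s x; rewrite -index_mem size_tuple. Qed.

(** Each vertex occupies exactly one position, so its sign can be looked up there; the default
    [None] is never reached. *)
Lemma mem_sign_class (V : finType) (s : lin_order V) (X : #|V|.-tuple sign)
    (b : bool) (x : V) :
  (x \in sign_class s X b) = (nth None X (index x (val s)) == Some b).
Proof.
apply/imsetP/idP => [[j]|Xb].
  rewrite inE (tnth_nth None) => Xj ->.
  by rewrite (tnth_nth x) index_uniq ?size_tuple ?(valP s).
exists (Ordinal (index_lin_order s x)); first by rewrite inE (tnth_nth None).
by rewrite (tnth_nth x) nth_index ?mem_lin_order.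
Qed.

Section SumOrder.
Variables (A B : finType) (s : lin_order A) (t : lin_order B).

Definition sum_seq : seq (A + B) := map inl (val s) ++ map inr (val t).

Lemma size_sum_seq : size sum_seq == #|{: A + B}|.
Proof. by rewrite size_cat !size_map !size_tuple card_sum. Qed.

Lemma uniq_sum_seq : uniq sum_seq.
Proof.
rewrite cat_uniq !map_inj_uniq ?(valP s) ?(valP t) ?andbT; try by move=> ? ? [].
by apply/hasPn => _ /mapP[y _ ->]; apply/mapP => -[].
Qed.

Definition sum_order : lin_order (A + B)%type :=
  exist _ (Tuple size_sum_seq) uniq_sum_seq.

Variable X : #|{: A + B}|.-tuple sign.

Lemma size_ltake : size (take #|A| X) == #|A|.
Proof. by rewrite size_takel // size_tuple card_sum leq_addr. Qed.

Lemma size_rdrop : size (drop #|A| X) == #|B|.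
Proof. by rewrite size_drop size_tuple card_sum addKn. Qed.

Definition ltake : #|A|.-tuple sign := Tuple size_ltake.
Definition rdrop : #|B|.-tuple sign := Tuple size_rdrop.

Lemma sign_class_sum_order (b : bool) :
  sign_class sum_order X b =
  sum_set (sign_class s ltake b) (sign_class t rdrop b).
Proof.
apply/setP => -[x|x]; rewrite mem_sign_class inE mem_sign_class /= index_cat.
  rewrite mem_map ?mem_lin_order ?index_map; try by move=> ? ? [].
  by rewrite nth_take ?index_lin_order.
(* A right vertex is absent from the first block, so its index is shifted by [#|A|], which matches
   the entries dropped from [X]. *)
rewrite ifN; last by apply/mapP => -[].
rewrite size_map size_tuple index_map; last by move=> ? ? [].
by rewrite nth_drop.
Qed.

End SumOrder.

Lemma alternating_cat (s1 s2 : seq sign) :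
  alternating (s1 ++ s2) -> alternating s1 && alternating s2.
Proof.
rewrite /alternating mem_cat negb_or => /andP[/andP[-> ->]] /=.
by move=> /cat_sorted2[-> ->].
Qed.

Lemma leq_alternation (n : nat) (X : n.-tuple sign) (m : bitseq) :
  size m = n -> alternating (mask m X) -> size (mask m X) <= alternation X.
Proof.
by move=> /eqP sz_m; apply: (leq_bigmax_cond (Tuple sz_m)
  (F := fun m : n.-tuple bool => size (mask m X))).
Qed.

Lemma alternation_le (n : nat) (X : n.-tuple sign) : alternation X <= n.
Proof.
apply/bigmax_leqP => m _.
by rewrite size_mask ?size_tuple // (leq_trans (count_size _ _)) ?size_tuple.
Qed.

(** Cut an optimal mask at position [#|A|]: both pieces of an alternating subsequence alternate, and
    their lengths add up. *)
Lemma alternation_split (A B : finType) (X : #|{: A + B}|.-tuple sign) :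
  alternation X <= alternation (ltake X) + alternation (rdrop X).
Proof.
apply/bigmax_leqP => m.
have sz1 : size (take #|A| m) = #|A|.
  by rewrite size_takel // size_tuple card_sum leq_addr.
have sz2 : size (drop #|A| m) = #|B|.
  by rewrite size_drop size_tuple card_sum addKn.
have -> : mask m X =
    mask (take #|A| m) (ltake X) ++ mask (drop #|A| m) (rdrop X).
  by rewrite -mask_cat /= ?cat_take_drop // sz1 (eqP (size_ltake X)).
move=> /alternating_cat/andP[a1 a2].
by rewrite size_cat leq_add // leq_alternation.
Qed.

Lemma contains_edge_sum (G H : hypergraph) (P : {set hvertex G})
    (Q : {set hvertex H}) :
  contains_edge P -> contains_edge Q ->
  @contains_edge (sum_hypergraph G H) (sum_set P Q).
Proof.
move=> /existsP[e /andP[eG /subsetP eP]] /existsP[f /andP[fH /subsetP fQ]].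
apply/existsP; exists (sum_set e f); rewrite sum_set_hedge //=.
by apply/subsetP => -[x|x]; rewrite !inE; [apply: eP | apply: fQ].
Qed.

Lemma leq_alt_ord (G : hypergraph) (s : lin_order (hvertex G))
    (X : #|hvertex G|.-tuple sign) :
  ~~ contains_edge (sign_class s X true) ->
  ~~ contains_edge (sign_class s X false) -> alternation X <= alt_ord s.
Proof. by move=> Xt Xf; apply: leq_bigmax_cond; rewrite Xt Xf. Qed.

Lemma leq_salt_ord (G : hypergraph) (s : lin_order (hvertex G))
    (X : #|hvertex G|.-tuple sign) (b : bool) :
  ~~ contains_edge (sign_class s X b) -> alternation X <= salt_ord s.
Proof.
by move=> Xb; apply: leq_bigmax_cond; rewrite negb_and; case: b Xb => ->;
  rewrite ?orbT.
Qed.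

Lemma alt_ord_sum_order (G H : hypergraph) (s : lin_order (hvertex G))
    (t : lin_order (hvertex H)) :
  @alt_ord (sum_hypergraph G H) (sum_order s t) <=
  maxn (maxn (#|hvertex G| + alt_ord t) (#|hvertex H| + alt_ord s))
       (salt_ord s + salt_ord t).
Proof.
apply/bigmax_leqP => X /andP[Xt Xf].
apply: leq_trans (alternation_split X) _; rewrite !leq_max.
(* If both halves of a sign class contained an edge, the union of these edges would lie in the
   class. *)
have miss b : ~~ @contains_edge (sum_hypergraph G H)
                   (sign_class (sum_order s t) X b) ->
    ~~ contains_edge (sign_class s (ltake X) b) \/
    ~~ contains_edge (sign_class t (rdrop X) b).
  move=> Xb; apply/orP; rewrite -negb_and; apply: contra Xb => /andP[Yb Zb].
  by rewrite sign_class_sum_order contains_edge_sum.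
case: (miss _ Xt) => [Yt|Zt]; case: (miss _ Xf) => [Yf|Zf].
- by rewrite [#|hvertex H| + _]addnC (leq_add (leq_alt_ord Yt Yf)) ?orbT //
    alternation_le.
- by rewrite (leq_add (leq_salt_ord Yt) (leq_salt_ord Zf)) ?orbT.
- by rewrite (leq_add (leq_salt_ord Yf) (leq_salt_ord Zt)) ?orbT.
- by rewrite (leq_add _ (leq_alt_ord Zt Zf)) // alternation_le.
Qed.

(** Induction over the list of orderings: [s] occurs in it, and each further [minn] can only lower
    the value. *)
Lemma alt_le_alt_ord (G : hypergraph) (s : lin_order (hvertex G)) :
  alt G <= alt_ord s.
Proof.
rewrite /alt; elim: (index_enum _) (mem_index_enum s) => // r l IHl.
by rewrite inE big_cons geq_min => /predU1P[<-|/IHl ->];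
  rewrite ?leqnn ?orbT.
Qed.

Theorem theorem2 (G H : hypergraph)
    (sigma : lin_order (hvertex G)) (tau : lin_order (hvertex H))
    (zG zH zGH : nat)
    (zetaG : altermatic_number (KG G) zG)
    (zetaH : altermatic_number (KG H) zH)
    (zetaGH : altermatic_number (gprod (KG G) (KG H)) zGH)
    (zG_sigma : zG = #|hvertex G| - alt_ord sigma)
    (zH_tau : zH = #|hvertex H| - alt_ord tau)
    (Hmax : maxn (#|hvertex G| + alt_ord tau) (#|hvertex H| + alt_ord sigma)
            >= salt_ord sigma + salt_ord tau) :
  zGH >= minn zG zH.
Proof.
case: zetaGH => _ zGH_max.
(* The sum hypergraph competes in the maximum defining [zGH], so its value is a lower bound. *)
apply: (leq_trans _ (zGH_max (#|hvertex (sum_hypergraph G H)| - alt _) _));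
  last by exists (sum_hypergraph G H); first exact: KG_sum_hypergraph.
rewrite [#|_|]card_sum.
have le_alt := leq_trans (alt_le_alt_ord _) (alt_ord_sum_order sigma tau).
(* The hypothesis absorbs the [salt_ord] term of the bound. *)
rewrite (maxn_idPl Hmax) in le_alt.
apply: leq_trans (leq_sub2l _ le_alt).
rewrite zG_sigma zH_tau geq_min.
(* Whichever term attains the maximum, one vertex count cancels: [#|hvertex G| + alt_ord tau] leaves
   [zH], and the other term leaves [zG]. *)
case: (leqP (_ + alt_ord tau)) => _; last by rewrite subnDl leqnn orbT.
by rewrite [#|_| + #|_|]addnC subnDl leqnn.
Qed.
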